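(* Let $X$ be a compact Hausdorff space. The Hilbert $C(X)$-module $l_2(C(X))$ is not $C^*$-reflexive if and only if there exists a sequence $\{U_k\}_{k\in\mathbb N}$ of non-empty, pairwise disjoint open subsets of $X$ such that $\prod_k C_0(U_k)$ is canonically included into $C(X)$.
   Context: For a $C^*$-algebra $A$, $l_2(A)$ is the right Hilbert $A$-module of sequences $(a_i)$ in $A$ with $\sum_i a_i^*a_i$ norm convergent, inner product $\langle a,b\rangle=\sum_i a_i^*b_i$. For a Hilbert $A$-module $M$, $M'$ is the module of bounded $A$-module maps $M\to A$ and $M''=(M')'$ (Paschke's conventions); there is a canonical isometric inclusion $M\subseteq M''$, and $M$ is $C^*$-reflexive if $M''=M$. For an open $U\subseteq X$, $C_0(U)$ is identified with the ideal of functions in $C(X)$ vanishing on $X\setminus U$. For pairwise disjoint open $U_k$, $\prod_k C_0(U_k)$ is the $C^*$-algebra of bounded sequences $(\lambda_k)$, $\lambda_k\in C_0(U_k)$, with sup norm. We say $\prod_kC_0(U_k)$ is canonically included into $C(X)$ if the canonical inclusion $\bigoplus_kC_0(U_k)\subseteq C(X)$ extends to an inclusion of $\prod_kC_0(U_k)$, i.e. for every bounded sequence $(\lambda_k)$, $\lambda_k\in C_0(U_k)$, there is a (necessarily unique) continuous function on $X$ which equals $\lambda_k$ on each $U_k$ and vanishes on $X\setminus\overline{\bigcup_k U_k}$. *)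

(* Defs.v *)
From HB Require Import structures.
From mathcomp Require Import all_boot all_order all_algebra.
From mathcomp Require Import all_classical all_reals topology normedtype.
From mathcomp.real_closed Require Import complex.
Import Order.TTheory GRing.Theory Num.Theory numFieldNormedType.Exports.
Local Open Scope ring_scope.
Local Open Scope classical_set_scope.

(* Complex scalars are R[i] for a real field R : realType.  A function
   X -> R[i] is continuous iff its real and imaginary parts are.  *)
Definition ccont {R : realType} {X : topologicalType} (f : X -> R[i]) : Prop :=
  continuous (fun x => complex.Re (f x)) /\ continuous (fun x => complex.Im (f x)).

Definition cnorm {R : realType} (z : R[i]) : R := Normc.normc z.
Definition cabs2 {R : realType} (z : R[i]) : R :=
  complex.Re z ^+ 2 + complex.Im z ^+ 2.

Definition seqX (R : realType) (X : topologicalType) := nat -> X -> R[i].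

Definition psum {R : realType} {X : topologicalType} (a : seqX R X) (n : nat) (x : X) : R :=
  \sum_(i < n) cabs2 (a i x).

(* a in l_2(C(X)): each a_i in C(X), and sum_i a_i^* a_i is norm (= uniformly)
   convergent in C(X). *)
Definition is_l2 {R : realType} {X : topologicalType} (a : seqX R X) : Prop :=
  (forall i, ccont (a i)) /\
  exists g : X -> R, continuous g /\
    forall e : R, 0 < e -> exists N : nat, forall n : nat, (N <= n)%N ->
      forall x, `|psum a n x - g x| <= e.

(* ||a|| <= c  in l_2(C(X)), i.e. ||<a,a>||_oo <= c^2 *)
Definition l2le {R : realType} {X : topologicalType} (a : seqX R X) (c : R) : Prop :=
  forall n x, psum a n x <= c ^+ 2.

Definition functional (R : realType) (X : topologicalType) := seqX R X -> X -> R[i].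

Definition fbound {R : realType} {X : topologicalType} (f : functional R X) (L : R) : Prop :=
  forall (a : seqX R X) (c : R), is_l2 a -> 0 <= c -> l2le a c ->
    forall x, cnorm (f a x) <= L * c.

Definition in_dual {R : realType} {X : topologicalType} (f : functional R X) : Prop :=
  [/\ forall a, is_l2 a -> ccont (f a),
      forall a b, is_l2 a -> is_l2 b ->
        forall x, f (fun i y => a i y + b i y) x = f a x + f b x,
      forall a (b : X -> R[i]), is_l2 a -> ccont b ->
        forall x, f (fun i y => a i y * b y) x = f a x * b x
    & exists L : R, fbound f L].

(* F in M'' = bounded C(X)-module maps M' -> C(X), where M' carries Paschke's
   module structure (f b)(a) = b^* f(a); F must be well defined on M'. *)
Definition in_bidual {R : realType} {X : topologicalType}
    (F : functional R X -> X -> R[i]) : Prop :=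
  [/\ forall f, in_dual f -> ccont (F f),
      forall f g, in_dual f -> in_dual g ->
        (forall a, is_l2 a -> forall x, f a x = g a x) -> forall x, F f x = F g x,
      forall f g, in_dual f -> in_dual g ->
        forall x, F (fun a y => f a y + g a y) x = F f x + F g x,
      forall f (b : X -> R[i]), in_dual f -> ccont b ->
        forall x, F (fun a y => conjc (b y) * f a y) x = F f x * b x
    & exists K : R, forall f (L : R), in_dual f -> 0 <= L -> fbound f L ->
        forall x, cnorm (F f x) <= K * L].

(* l_2(C(X)) is C*-reflexive: the canonical inclusion a |-> (f |-> f(a)^* ) of
   l_2(C(X)) into its bidual is onto. *)
Definition l2_reflexive (R : realType) (X : topologicalType) : Prop :=
  forall F : functional R X -> X -> R[i], in_bidual F ->
    exists a : seqX R X, is_l2 a /\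
      forall f, in_dual f -> forall x, F f x = conjc (f a x).

(* f in C_0(U), viewed as an ideal of C(X) *)
Definition in_C0 {R : realType} {X : topologicalType} (U : set X) (f : X -> R[i]) : Prop :=
  ccont f /\ forall x, ~ U x -> f x = 0.

Definition prod_canon_incl (R : realType) {X : topologicalType} (U : nat -> set X) : Prop :=
  forall lam : nat -> X -> R[i],
    (forall k, in_C0 (U k) (lam k)) ->
    (exists B : R, forall k x, cnorm (lam k x) <= B) ->
    exists g : X -> R[i], [/\ ccont g,
      (forall k x, U k x -> g x = lam k x) &
      (forall x, ~ closure (\bigcup_k U k) x -> g x = 0)].

(* Main.v *)
Require Import Defs.
From HB Require Import structures.
From mathcomp Require Import all_boot all_order all_algebra.
From mathcomp Require Import all_classical all_reals topology normedtype.
From mathcomp.real_closed Require Import complex.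
From mathcomp Require Import sequences realfun ring lra.
Import Order.TTheory GRing.Theory Num.Theory numFieldNormedType.Exports.
Local Open Scope ring_scope.
Local Open Scope classical_set_scope.

(** An element [F] of the bidual is determined by its coordinates [F_i = F (proj i)], whose
    partial sums of squares [s_n] are uniformly bounded.

    If [s_n] converges uniformly, then [F] minus the evaluation at the conjugate sequence kills
    every [proj i], hence is zero: given [f] in the dual and a point where the value is nonzero,
    pick nearby [n] and [y] with the [n]-th partial sum of squares of [f] at [y] almost equal to
    the local supremum of all these sums; then the tail of [f] is small around [y].

    Otherwise some consecutive blocks of [sum |F_i|^2] exceed a fixed [e > 0] on nonempty open
    sets of bounded multiplicity, and these can be shrunk to disjoint [U_k].  A bounded sequence
    [lam_k] in [C_0(U_k)] is then glued by [F f], where on [U_k] the functional [f] has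
    coefficients [conj (lam_k) F_i / (sum of |F_i|^2 over the k-th block)].

    Conversely, with bumps [h_k] supported in [U_k], gluing [h_k conj (f_k)] defines an element
    of the bidual whose coordinates [h_k] are not uniformly square summable. *)

(** * Scalar inequalities for the squared modulus *)

Section ComplexScalars.
Context {R : realType}.
Implicit Types (z w : R[i]) (c : R).

Lemma cabs2_ge0 z : 0 <= cabs2 z.
Proof. by rewrite addr_ge0 ?sqr_ge0. Qed.

Lemma cnorm_ge0 z : 0 <= cnorm z.
Proof. by case: z => a b; exact: sqrtr_ge0. Qed.

Lemma cnorm_sqr z : cnorm z ^+ 2 = cabs2 z.
Proof. by case: z => a b; rewrite /cnorm /= sqr_sqrtr// addr_ge0 ?sqr_ge0. Qed.

Lemma cnorm_leP z c : 0 <= c -> (cnorm z <= c) = (cabs2 z <= c ^+ 2).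
Proof. by move=> c0; rewrite -cnorm_sqr ler_pXn2r ?nnegrE// cnorm_ge0. Qed.

Lemma cabs2_le z c : cnorm z <= c -> cabs2 z <= c ^+ 2.
Proof. by move=> zc; rewrite -cnorm_leP// (le_trans (cnorm_ge0 z)). Qed.

Lemma cabs20 : cabs2 (0 : R[i]) = 0.
Proof. by rewrite /cabs2 /= expr0n addr0. Qed.

Lemma cabs2_eq0 z : cabs2 z = 0 -> z = 0.
Proof.
case: z => a b /eqP; rewrite paddr_eq0 ?sqr_ge0// !sqrf_eq0 /=.
by case/andP => /eqP -> /eqP ->.
Qed.

Lemma cabs2M z w : cabs2 (z * w) = cabs2 z * cabs2 w.
Proof. by case: z w => [a b] [c d]; rewrite /cabs2 /=; ring. Qed.

Lemma cabs2J z : cabs2 (conjc z) = cabs2 z.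
Proof. by case: z => a b; rewrite /cabs2 /= sqrrN. Qed.

Lemma conjcN z : conjc (- z) = - conjc z.
Proof. exact: (rmorphN conjc). Qed.

Lemma conjcD z w : conjc (z + w) = conjc z + conjc w.
Proof. exact: (rmorphD conjc). Qed.

Lemma conjcM z w : conjc (z * w) = conjc z * conjc w.
Proof. exact: (rmorphM conjc). Qed.

Lemma real_complexM c (c' : R) : ((c * c')%:C = c%:C * c'%:C)%C.
Proof. exact: (rmorphM (real_complex R)). Qed.

Lemma cabs2_real c : cabs2 (c%:C)%C = c ^+ 2.
Proof. by rewrite /cabs2 /= expr0n addr0. Qed.

Lemma mulJc z : conjc z * z = ((cabs2 z)%:C)%C.
Proof.
case: z => a b; apply/eqP; rewrite eq_complex /cabs2 /=.
by apply/andP; split; apply/eqP; ring.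
Qed.

Lemma ler_of_sqr (s t : R) : 0 <= t -> s ^+ 2 <= t ^+ 2 -> s <= t.
Proof. by move=> t0 st; rewrite leNgt; apply/negP => ts; nra. Qed.

Lemma norm_le_of_sqr (s t : R) : 0 <= t -> s ^+ 2 <= t ^+ 2 -> `|s| <= t.
Proof. by move=> t0 st; apply: ler_of_sqr => //; rewrite real_normK ?num_real. Qed.

(** This is the induction step of Cauchy-Schwarz, with [p], [q] and [p'], [q'] standing for the two
    pairs of sums. The cross term is twice [Re (z * conjc w)], whose square is at most [p q p' q'],
    and the arithmetic-geometric mean inequality bounds it by [p q' + p' q]. *)
Lemma cabs2D_cauchy z w (p q p' q' : R) : 0 <= p -> 0 <= q -> 0 <= p' -> 0 <= q' ->
  cabs2 z <= p * q -> cabs2 w <= p' * q' -> cabs2 (z + w) <= (p + p') * (q + q').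
Proof.
move=> p0 q0 p'0 q'0 hz hw.
pose t := complex.Re z * complex.Re w + complex.Im z * complex.Im w.
have tzw : t ^+ 2 <= cabs2 z * cabs2 w.
  rewrite -subr_ge0.
  suff -> : cabs2 z * cabs2 w - t ^+ 2 =
    (complex.Re z * complex.Im w - complex.Im z * complex.Re w) ^+ 2.
    exact: sqr_ge0.
  by rewrite /cabs2 /t; ring.
have zw : cabs2 z * cabs2 w <= (p * q) * (p' * q').
  by apply: ler_pM => //; exact: cabs2_ge0.
have t2 : 2 * t <= p * q' + p' * q.
  apply: ler_of_sqr; first by rewrite addr_ge0 ?mulr_ge0.
  rewrite exprMn; have := sqr_ge0 (p * q' - p' * q); nra.
have -> : cabs2 (z + w) = cabs2 z + cabs2 w + 2 * t.
  by case: z w @t {hz hw tzw zw t2} => [a b] [c d]; rewrite /cabs2 /=; ring.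
by nra.
Qed.

Lemma cauchy_schwarz (I : Type) (r : seq I) (P : pred I) (u v : I -> R[i]) :
  cabs2 (\sum_(i <- r | P i) u i * v i)
    <= (\sum_(i <- r | P i) cabs2 (u i)) * \sum_(i <- r | P i) cabs2 (v i).
Proof.
elim: r => [|i r IH]; first by rewrite !big_nil cabs20 mul0r.
rewrite !big_cons; case: (P i) => //.
have s0 (f : I -> R[i]) : 0 <= \sum_(j <- r | P j) cabs2 (f j).
  by apply: sumr_ge0 => j _; exact: cabs2_ge0.
by apply: cabs2D_cauchy; rewrite ?cabs2_ge0 ?s0// cabs2M.
Qed.

Lemma cnormD_le z w : cnorm (z + w) <= cnorm z + cnorm w.
Proof. exact: le_normcD. Qed.

End ComplexScalars.

(** * Continuous complex functions, uniform limits and Urysohn bumps *)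

Section ComplexContinuity.
Context {R : realType} {X : topologicalType}.
Implicit Types f g : X -> R[i].

Lemma ccont0 : ccont (fun=> 0 : R[i]) (X := X).
Proof. by split=> x; exact: cvg_cst. Qed.

Lemma ccontD f g : ccont f -> ccont g -> ccont (fun x => f x + g x).
Proof.
move=> [f1 f2] [g1 g2]; split.
  rewrite (_ : (fun _ => _) = (fun y => complex.Re (f y) + complex.Re (g y))).
    by move=> x; apply: cvgD; [exact: f1|exact: g1].
  by apply/funext => y; case: (f y) (g y) => [? ?] [].
rewrite (_ : (fun _ => _) = (fun y => complex.Im (f y) + complex.Im (g y))).
  by move=> x; apply: cvgD; [exact: f2|exact: g2].
by apply/funext => y; case: (f y) (g y) => [? ?] [].
Qed.

Lemma ccontM f g : ccont f -> ccont g -> ccont (fun x => f x * g x).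
Proof.
move=> [f1 f2] [g1 g2]; split.
  rewrite (_ : (fun _ => _) = (fun y => complex.Re (f y) * complex.Re (g y)
     - complex.Im (f y) * complex.Im (g y))).
    by move=> x; apply: cvgB; apply: cvgM; [exact: f1|exact: g1|exact: f2|exact: g2].
  by apply/funext => y; case: (f y) (g y) => [? ?] [].
rewrite (_ : (fun _ => _) = (fun y => complex.Re (f y) * complex.Im (g y)
     + complex.Im (f y) * complex.Re (g y))).
  by move=> x; apply: cvgD; apply: cvgM; [exact: f1|exact: g2|exact: f2|exact: g1].
by apply/funext => y; case: (f y) (g y) => [? ?] [].
Qed.

Lemma ccontJ f : ccont f -> ccont (fun x => conjc (f x)).
Proof.
move=> [f1 f2]; split.
  rewrite (_ : (fun _ => _) = (fun y => complex.Re (f y))); first exact: f1.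
  by apply/funext => y; case: (f y).
rewrite (_ : (fun _ => _) = (fun y => - complex.Im (f y))).
  by move=> x; apply: cvgN; exact: f2.
by apply/funext => y; case: (f y).
Qed.

Lemma ccont_real (h : X -> R) : continuous h -> ccont (fun x => ((h x)%:C)%C).
Proof. by move=> ch; split=> x; [exact: ch|exact: cvg_cst]. Qed.

Lemma ccont1 : ccont (fun=> 1 : R[i]) (X := X).
Proof. by split=> x; exact: cvg_cst. Qed.

Lemma ccont_sum (I : Type) (r : seq I) (P : pred I) (F : I -> X -> R[i]) :
  (forall i, ccont (F i)) -> ccont (fun x => \sum_(i <- r | P i) F i x).
Proof.
move=> cF; elim: r => [|i r IH].
  by under eq_fun do rewrite big_nil; exact: ccont0.
under eq_fun do rewrite big_cons.
by case: (P i) => //; exact: ccontD.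
Qed.

Lemma continuous_cabs2 f : ccont f -> continuous (fun x => cabs2 (f x)).
Proof.
by move=> [f1 f2] x; apply: cvgD; apply: cvgM; [exact: f1|exact: f1|exact: f2|exact: f2].
Qed.

Lemma continuous_uniform_limit (u : X -> R) :
  (forall e : R, 0 < e ->
    exists2 v : X -> R, continuous v & forall x, `|u x - v x| <= e) ->
  continuous u.
Proof.
move=> H x; apply/cvgrPdist_le => e e0.
have e3 : 0 < e / 3 by rewrite divr_gt0.
have [v cv uv] := H _ e3.
have := cv x; move/cvgrPdist_le => /(_ _ e3); apply: filterS => y vy.
rewrite (_ : u x - u y = (u x - v x) + (v x - v y) - (u y - v y)); last by ring.
rewrite (le_trans (ler_normB _ _))// (_ : e = e / 3 + e / 3 + e / 3); last by field.
by apply: lerD => //; rewrite (le_trans (ler_normD _ _))// lerD.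
Qed.

Lemma ccont_uniform_limit f :
  (forall e : R, 0 < e ->
    exists2 g : X -> R[i], ccont g & forall x, cabs2 (f x - g x) <= e ^+ 2) ->
  ccont f.
Proof.
move=> H; split; apply: continuous_uniform_limit => e e0;
  have [g [c1 c2] fg] := H _ e0.
- exists (fun x => complex.Re (g x)) => // x.
  apply: norm_le_of_sqr; [exact: ltW|apply: le_trans (fg x)].
  by rewrite /cabs2; case: (f x) (g x) => [? ?] [? ?] /=; rewrite lerDl sqr_ge0.
- exists (fun x => complex.Im (g x)) => // x.
  apply: norm_le_of_sqr; [exact: ltW|apply: le_trans (fg x)].
  by rewrite /cabs2; case: (f x) (g x) => [? ?] [? ?] /=; rewrite lerDr sqr_ge0.
Qed.

Lemma open_superlevel (u : X -> R) (c : R) : continuous u -> open [set x | c < u x].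
Proof.
move=> cu; apply: (@open_comp _ _ u [set t | c < t]) => [x _|]; first exact: cu.
exact: open_gt.
Qed.

Lemma closure_le (u : X -> R) (c : R) (D : set X) : continuous u ->
  (forall x, D x -> u x <= c) -> forall x, closure D x -> u x <= c.
Proof.
move=> cu uc x Dx; rewrite leNgt; apply/negP => cux.
have [|y [Dy]] := Dx [set y | c < u y].
  by apply: open_nbhs_nbhs; split => //; exact: open_superlevel.
by rewrite /= ltNge uc.
Qed.

Lemma urysohn_bump (hcomp : compact [set: X]) (hhaus : hausdorff_space X)
    (U : set X) (x : X) : open U -> U x ->
  exists h : X -> R, [/\ continuous h, forall y, 0 <= h y <= 1, h x = 1
    & forall y, ~ U y -> h y = 0].
Proof.
move=> oU Ux.
have sep : uniform_separator (~` U) [set x].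
  apply: normal_uniform_separator; first exact: compact_normal.
  - exact: open_closedC.
  - by apply: accessible_closed_set1; exact: hausdorff_accessible.
  - by apply/seteqP; split => y // [/= nU yx]; apply: nU; rewrite yx.
exists (Urysohn (~` U) [set x]); split.
- exact: Urysohn_continuous.
- by move=> y; have := @Urysohn_range _ R (~` U) [set x] _ (imageT _ y); rewrite /= in_itv.
- by apply: (Urysohn_sub1 sep); exists x.
- by move=> y nUy; apply: (Urysohn_sub0 sep); exists y.
Qed.

End ComplexContinuity.

(** * Sequences in $l_2(C(X))$ and their partial sums of squares *)

Section SquareSummable.
Context {R : realType} {X : topologicalType}.
Implicit Types (a b : seqX R X) (n m : nat) (x : X).

Lemma psum_ge0 a n x : 0 <= psum a n x.
Proof. by apply: sumr_ge0 => i _; exact: cabs2_ge0. Qed.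

Lemma psumS a n x : psum a n.+1 x = psum a n x + cabs2 (a n x).
Proof. by rewrite /psum big_ord_recr. Qed.

Lemma psum_nondecreasing a x m n : (m <= n)%N -> psum a m x <= psum a n x.
Proof.
move=> /subnKC <-; elim: (n - m)%N => [|k IH]; first by rewrite addn0.
by rewrite addnS psumS (le_trans IH)// lerDl cabs2_ge0.
Qed.

Lemma cabs2_le_psum a x i n : (i < n)%N -> cabs2 (a i x) <= psum a n x.
Proof.
by move=> /(psum_nondecreasing a x); apply: le_trans; rewrite psumS lerDr psum_ge0.
Qed.

Lemma psumB a x m n : (m <= n)%N ->
  psum a n x - psum a m x = \sum_(m <= i < n) cabs2 (a i x).
Proof.
move=> mn; rewrite /psum -!(big_mkord xpredT (fun i => cabs2 (a i x))).
by rewrite (big_cat_nat (leq0n m) mn) /= addrAC subrr add0r.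
Qed.

Lemma continuous_psum a n : (forall i, ccont (a i)) -> continuous (psum a n).
Proof.
move=> ca; elim: n => [|n IH].
  rewrite (_ : psum a 0 = fun=> 0) => [x|]; first exact: cvg_cst.
  by apply/funext => x; rewrite /psum big_ord0.
rewrite (_ : psum a n.+1 = fun x => psum a n x + cabs2 (a n x)); last first.
  by apply/funext => x; rewrite psumS.
by move=> x; apply: cvgD; [exact: IH|exact: continuous_cabs2].
Qed.

(** Partial sums increase, so a one-sided comparison with the single index [N] already expresses the
    uniform Cauchy condition. *)
Definition uniformly_cauchy a := forall e : R, 0 < e ->
  exists N, forall n, (N <= n)%N -> forall x, psum a n x - psum a N x <= e.

Lemma is_l2_cauchy a : is_l2 a -> uniformly_cauchy a.
Proof.
move=> [ca [g [cg ga]]] e e0; have e2 : 0 < e / 2 by rewrite divr_gt0.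
have [N HN] := ga _ e2; exists N => n Nn x.
have := HN _ Nn x; have := HN _ (leqnn N) x.
by rewrite !ler_norml => /andP[? _] /andP[_ ?]; lra.
Qed.

(** The limit is the pointwise supremum of the increasing partial sums; the Cauchy condition makes
    the convergence uniform, so the limit is continuous. *)
Lemma cauchy_is_l2 a : (forall i, ccont (a i)) -> uniformly_cauchy a -> is_l2 a.
Proof.
move=> ca Ca; split=> //.
pose g x := sup (range (fun n => psum a n x)).
have ubd x : has_ubound (range (fun n => psum a n x)).
  have [N HN] := Ca 1 ltr01; exists (psum a N x + 1) => _ [n _ <-].
  have [Nn|nN] := leqP N n; first by have := HN _ Nn x; lra.
  by have := psum_nondecreasing a x _ _ (ltnW nN); lra.
have le_g n x : psum a n x <= g x by apply: ub_le_sup => //; exists n.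
have gle e : 0 < e -> exists N, forall x n, (N <= n)%N -> `|psum a n x - g x| <= e.
  move=> e0; have [N HN] := Ca _ e0; exists N => x n Nn.
  rewrite distrC ger0_norm ?subr_ge0// lerBlDl.
  apply: ge_sup; first by exists (psum a 0 x), 0%N.
  move=> _ [m _ <-]; have Nnx := psum_nondecreasing a x _ _ Nn.
  have [Nm|mN] := leqP N m; first by have := HN _ Nm x; lra.
  by have := psum_nondecreasing a x _ _ (ltnW mN); lra.
exists g; split.
  apply: continuous_uniform_limit => e e0; have [N HN] := gle _ e0.
  by exists (psum a N) => [|x]; [exact: continuous_psum|rewrite distrC HN].
by move=> e /gle[N HN]; exists N => n Nn x; exact: HN.
Qed.

Lemma is_l2_dominated a b (C : R) : (forall i, ccont (b i)) -> is_l2 a ->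
  (forall i x, cabs2 (b i x) <= C * cabs2 (a i x)) -> is_l2 b.
Proof.
move=> cb l2a ba; apply: cauchy_is_l2 => // e e0.
have C1 : 0 < `|C| + 1 by rewrite ltr_wpDl.
have [N HN] := is_l2_cauchy _ l2a (e / (`|C| + 1)) (divr_gt0 e0 C1).
exists N => n Nn x; have := HN _ Nn x.
rewrite ler_pdivlMr// => /(le_trans _); apply.
rewrite !psumB// mulr_suml; apply: ler_sum => i _.
rewrite (le_trans (ba i x))// mulrC ler_wpM2l ?cabs2_ge0//.
by rewrite (le_trans (ler_norm C))// lerDl.
Qed.

Definition head n a : seqX R X := fun i x => if (i < n)%N then a i x else 0.
Definition tail n a : seqX R X := fun i x => if (i < n)%N then 0 else a i x.

Lemma psum_head n a m x : psum (head n a) m x = psum a (minn m n) x.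
Proof.
elim: m => [|m IH]; first by rewrite min0n /psum !big_ord0.
rewrite psumS IH /head; have [mn|nm] := ltnP m n.
  by rewrite (minn_idPl mn) psumS.
by rewrite cabs20 addr0 (minn_idPr (leqW nm)).
Qed.

Lemma is_l2_head n a : (forall i, ccont (a i)) -> is_l2 (head n a).
Proof.
move=> ca; apply: cauchy_is_l2 => [i|e e0].
  by rewrite /head; case: (i < n)%N => //; exact: ccont0.
exists n => m nm x; rewrite !psum_head (minn_idPr nm) minnn subrr; exact: ltW.
Qed.

Lemma is_l2_tail n a : is_l2 a -> is_l2 (tail n a).
Proof.
move=> l2a; apply: (is_l2_dominated a _ 1) => // [i|i x]; rewrite /tail.
  by case: (i < n)%N; [exact: ccont0|case: l2a].
by rewrite mul1r; case: ifP => _; rewrite ?cabs20 ?cabs2_ge0 ?lexx.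
Qed.

Lemma psum_tail n a m x :
  psum (tail n a) m x = if (m <= n)%N then 0 else psum a m x - psum a n x.
Proof.
elim: m => [|m IH]; first by rewrite /psum big_ord0.
rewrite psumS IH /tail; case: ltngtP => [mn|nm|->].
- by rewrite cabs20 addr0.
- by rewrite psumS addrAC.
- by rewrite add0r psumS addrAC subrr add0r.
Qed.

Lemma psum_tail_ge n a m x : (n <= m)%N -> psum (tail n a) m x = psum a m x - psum a n x.
Proof. by move=> nm; rewrite psum_tail; case: ltngtP nm => // <-; rewrite subrr. Qed.

Lemma l2le_tail a (c : R) : is_l2 a -> 0 < c -> exists n, l2le (tail n a) c.
Proof.
move=> l2a c0; have [N HN] := is_l2_cauchy _ l2a (c ^+ 2) (exprn_gt0 2 c0).
exists N => m x; have [mN|/ltnW Nm] := leqP m N.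
  by rewrite psum_tail mN sqr_ge0.
by rewrite psum_tail_ge// HN.
Qed.

Definition unit_seq n : seqX R X := fun i => cst (i == n)%:R.

Lemma ccont_unit_seq n i : ccont (unit_seq n i).
Proof. by rewrite /unit_seq; case: (i == n); [exact: ccont1|exact: ccont0]. Qed.

Lemma psum_unit_seq n m x : psum (unit_seq n) m x = (n < m)%N%:R.
Proof.
rewrite /psum; elim: m => [|m IH]; first by rewrite big_ord0.
rewrite big_ord_recr /= IH /unit_seq /cst ltnS; case: ltngtP => _.
- by rewrite cabs20 addr0.
- by rewrite cabs20 addr0.
- by rewrite add0r /cabs2 /= expr1n expr0n addr0.
Qed.

Lemma is_l2_unit_seq n : is_l2 (unit_seq n).
Proof.
apply: cauchy_is_l2 => [i|e e0]; first exact: ccont_unit_seq.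
exists n.+1 => m nm x; rewrite !psum_unit_seq nm ltnSn subrr; exact: ltW.
Qed.

Lemma l2le_unit_seq n : l2le (unit_seq n) 1.
Proof. by move=> m x; rewrite psum_unit_seq expr1n; case: leqP. Qed.

Lemma compact_bounded_above (u : X -> R) : compact [set: X] -> continuous u ->
  exists B, forall x, u x <= B.
Proof.
move=> cX cu; have : compact (u @` setT).
  by apply: continuous_compact => //; exact: continuous_subspaceT.
move=> /compact_bounded[M [_ HM]]; exists (M + 1) => x.
by rewrite (le_trans (ler_norm _))// HM ?ltrDl//; exists x.
Qed.

Lemma l2le_exists a : compact [set: X] -> is_l2 a -> exists2 c : R, 0 <= c & l2le a c.
Proof.
move=> cX l2a; have [N HN] := is_l2_cauchy _ l2a 1 ltr01.
have [B HB] : exists B, forall x, psum a N x <= B.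
  by apply: compact_bounded_above => //; apply: continuous_psum; case: l2a.
(* The head contributes at most [B] and the rest at most 1. Since [l2le] compares with a square, it
   helps that a number at least 1 is below its square. *)
exists (`|B| + 1) => [|m x]; first by rewrite addr_ge0.
have Bx := HB x; have B0 := ler_norm B; have nB := normr_ge0 B.
have : psum a m x <= `|B| + 1.
  have [Nm|/ltnW mN] := leqP N m; first by have := HN _ Nm x; lra.
  by have := psum_nondecreasing a x _ _ mN; lra.
by move=> /le_trans; apply; nra.
Qed.

End SquareSummable.

(** * The dual module: coordinates, norm bounds and finite functionals *)

Section Dual.
Context {R : realType} {X : topologicalType}.
Implicit Types (f : functional R X) (a c : seqX R X) (n m : nat) (x : X).

Lemma fbound_le f (L M : R) : fbound f L -> L <= M -> fbound f M.
Proof.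
move=> fL LM a c l2a c0 ac x; rewrite (le_trans (fL a c l2a c0 ac x))//.
exact: ler_wpM2r.
Qed.

Lemma dual_bound f : in_dual f -> exists2 L : R, 0 <= L & fbound f L.
Proof.
by move=> [_ _ _ [L fL]]; exists `|L| => //; apply: fbound_le fL _; exact: ler_norm.
Qed.

Definition coord f n : X -> R[i] := f (unit_seq n).

Lemma ccont_coord f n : in_dual f -> ccont (coord f n).
Proof. by case=> fc _ _ _; apply: fc; exact: is_l2_unit_seq. Qed.

Lemma is_l2_zero : is_l2 (fun _ _ => 0 : R[i]) (X := X).
Proof.
apply: cauchy_is_l2 => [i|e e0]; first exact: ccont0.
by exists 0%N => n _ x; rewrite /psum !big1 ?subrr ?ltW// => i _; rewrite cabs20.
Qed.

Lemma dual_zero f x : in_dual f -> f (fun _ _ => 0) x = 0.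
Proof.
move=> [_ _ fM _]; have fM0 := fM _ _ is_l2_zero ccont0 x.
rewrite -[RHS](mulr0 (f (fun _ _ => 0) x)) -fM0.
by congr (f _ x); apply/funext => i; apply/funext => y; rewrite mulr0.
Qed.

Lemma dual_head f a n x : in_dual f -> (forall i, ccont (a i)) ->
  f (head n a) x = \sum_(i < n) coord f i x * a i x.
Proof.
move=> hf ca; have [_ fD fM _] := hf; elim: n => [|n IH].
  by rewrite big_ord0 -(dual_zero f x hf); congr (f _ x).
have -> : head n.+1 a = fun i y => head n a i y + unit_seq n i y * a n y.
  apply/funext => i; apply/funext => y; rewrite /head /unit_seq /cst ltnS.
  by case: ltngtP => [_|_|->]; rewrite ?mul0r ?mul1r ?addr0 ?add0r.
have l2u : is_l2 (fun i y => unit_seq n i y * a n y).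
  apply: (is_l2_dominated (head n.+1 a) _ 1).
  - by move=> i; apply: ccontM; [exact: ccont_unit_seq|].
  - exact: is_l2_head.
  - move=> i y; rewrite /unit_seq /cst /head mul1r; case: eqP => [->|_].
      by rewrite ltnSn mul1r.
    by rewrite mul0r cabs20 cabs2_ge0.
rewrite fD//; last exact: is_l2_head.
by rewrite fM ?big_ord_recr ?IH//; exact: is_l2_unit_seq.
Qed.

Lemma dual_split f a n x : in_dual f -> is_l2 a ->
  f a x = \sum_(i < n) coord f i x * a i x + f (tail n a) x.
Proof.
move=> hf l2a; have ca : forall i, ccont (a i) by case: l2a.
rewrite -dual_head//; have [_ fD _ _] := hf.
rewrite -fD; [|exact: is_l2_head|exact: is_l2_tail].
congr (f _ x); apply/funext => i; apply/funext => y; rewrite /head /tail.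
by case: ifP; rewrite ?addr0 ?add0r.
Qed.

(** Cauchy-Schwarz controls every finite head of [a], and boundedness of [f] makes the contribution
    of the remaining tail arbitrarily small. A bound on the coordinates alone thus bounds the norm
    of [f]. *)
Lemma dual_cauchy_schwarz f a (S c : R) x : in_dual f -> is_l2 a ->
  0 <= S -> 0 <= c -> (forall m, psum (coord f) m x <= S ^+ 2) -> l2le a c ->
  cnorm (f a x) <= S * c.
Proof.
move=> hf l2a S0 c0 fS ac; have [L L0 fL] := dual_bound f hf.
(* A tail of norm at most [e / (L + 1)] has image at most [e]; adding 1 covers [L = 0]. *)
apply/ler_addgt0Pr => e e0; have L1 : 0 < L + 1 by rewrite ltr_wpDl.
have [n an] := l2le_tail a _ l2a (divr_gt0 e0 L1).
rewrite (dual_split f a n)// (le_trans (cnormD_le _ _))//; apply: lerD.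
  rewrite cnorm_leP ?mulr_ge0// (le_trans (cauchy_schwarz _ _ _ _ _))//.
  rewrite exprMn; apply: ler_pM; try exact: psum_ge0.
    exact: fS.
  exact: ac.
have eL : 0 <= e / (L + 1) by rewrite ltW ?divr_gt0.
rewrite (le_trans (fL _ _ (is_l2_tail n a l2a) eL an x))//.
by rewrite mulrA ler_pdivrMr// mulrDr mulr1 mulrC lerDl ltW.
Qed.

(** Adding 1 under the root keeps the factor continuous where all the entries vanish, while the
    first [n] entries still have square sum at most 1. *)
Definition normalize c n : seqX R X :=
  fun i x => c i x * (((Num.sqrt (1 + psum c n x))^-1)%:C)%C.

Lemma ccont_normalize c n i : (forall i, ccont (c i)) -> ccont (normalize c n i).
Proof.
move=> cc; apply: ccontM => //; apply: ccont_real => x.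
apply: cvgV.
  by rewrite sqrtr_eq0 -ltNge ltr_pwDl ?psum_ge0.
apply: continuous_cvg; first exact: sqrt_continuous.
by apply: cvgD; [exact: cvg_cst|exact: continuous_psum].
Qed.

Lemma cabs2_normalize c n i x :
  cabs2 (normalize c n i x) = cabs2 (c i x) / (1 + psum c n x).
Proof. by rewrite cabs2M cabs2_real exprVn sqr_sqrtr ?addr_ge0 ?psum_ge0. Qed.

Lemma psum_normalize c n x : psum (normalize c n) n x <= 1.
Proof.
rewrite /psum; under eq_bigr do rewrite cabs2_normalize.
rewrite -mulr_suml ler_pdivrMr ?mul1r ?lerDr//.
by rewrite ltr_pwDl ?psum_ge0.
Qed.

(** The hypothesis squares to [s ^+ 2 <= K ^+ 2 * (1 + s)], which fails as soon as [s] exceeds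
    [K ^+ 2 + 1]. It turns a value at a normalized sequence into a bound on the partial sum
    itself. *)
Lemma le_of_normalized (s K : R) : 0 <= s -> s / Num.sqrt (1 + s) <= K -> s <= K ^+ 2 + 1.
Proof.
move=> s0 sK.
have sq0 : 0 < Num.sqrt (1 + s) by rewrite sqrtr_gt0 ltr_pwDl.
move: sK; rewrite ler_pdivrMr// => sK.
have : s ^+ 2 <= K ^+ 2 * (1 + s).
  rewrite -(sqr_sqrtr (ltW (ltr_pwDl ltr01 s0))) -exprMn.
  by rewrite ler_pXn2r// nnegrE ?(le_trans s0).
by move=> ?; rewrite leNgt; apply/negP => ?; nra.
Qed.

(** Test [f] on the normalized conjugates of its own first [n] coordinates: the value is
    [s / sqrt (1 + s)], where [s] is the partial sum. *)
Lemma psum_coord_le f (L : R) n x : in_dual f -> fbound f L ->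
  psum (coord f) n x <= L ^+ 2 + 1.
Proof.
move=> hf fL; pose b := normalize (fun i y => conjc (coord f i y)) n.
have psumJ y : psum (fun i z => conjc (coord f i z)) n y = psum (coord f) n y.
  by apply: eq_bigr => i _; rewrite cabs2J.
have cb i : ccont (b i).
  by apply: ccont_normalize => j; apply: ccontJ; exact: ccont_coord.
have b1 : l2le (head n b) 1.
  move=> m y; rewrite psum_head expr1n.
  apply: (@le_trans _ _ (psum b n y)); last exact: psum_normalize.
  by apply: psum_nondecreasing; exact: geq_minr.
have := fL _ _ (is_l2_head n b cb) ler01 b1 x; rewrite mulr1 dual_head//.
have -> : \sum_(i < n) coord f i x * b i x =
    ((psum (coord f) n x / Num.sqrt (1 + psum (coord f) n x))%:C)%C.
  rewrite /psum mulr_suml rmorph_sum; apply: eq_bigr => i _.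
  by rewrite /b /normalize psumJ mulrA [_ * conjc _]mulrC mulJc -rmorphM.
move=> h; apply: le_of_normalized; first exact: psum_ge0.
apply: le_trans h; apply: ler_of_sqr; first exact: cnorm_ge0.
by rewrite cnorm_sqr cabs2_real.
Qed.

Definition fin_functional c n : functional R X :=
  fun a x => \sum_(i < n) c i x * a i x.

Lemma fbound_fin_functional c n (S : R) : 0 <= S ->
  (forall x, psum c n x <= S ^+ 2) -> fbound (fin_functional c n) S.
Proof.
move=> S0 cS a d l2a d0 ad x; rewrite cnorm_leP ?mulr_ge0//.
rewrite (le_trans (cauchy_schwarz _ _ _ _ _))// exprMn.
by apply: ler_pM; [exact: psum_ge0|exact: psum_ge0|exact: cS|exact: ad].
Qed.

Lemma in_dual_fin_functional c n : compact [set: X] -> (forall i, ccont (c i)) ->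
  in_dual (fin_functional c n).
Proof.
move=> cX cc; split.
- by move=> a [ca _]; apply: ccont_sum => i; exact: ccontM.
- move=> a b _ _ x; rewrite /fin_functional -big_split /=.
  by apply: eq_bigr => i _; rewrite mulrDr.
- move=> a b _ _ x; rewrite /fin_functional mulr_suml.
  by apply: eq_bigr => i _; rewrite mulrA.
- have [B HB] := compact_bounded_above _ cX (continuous_psum c n cc).
  exists (`|B| + 1); apply: fbound_fin_functional; first by rewrite addr_ge0.
  by move=> x; have := HB x; have := ler_norm B; have := normr_ge0 B; nra.
Qed.

End Dual.

(** * The bidual: bounded coordinates, and vanishing of elements with zero coordinates *)

Section Bidual.
Context {R : realType} {X : topologicalType}.
Hypothesis cX : compact [set: X].
Implicit Types (f : functional R X) (F : functional R X -> X -> R[i]).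
Implicit Types (a c : seqX R X) (n m : nat) (x : X).

Definition proj n : functional R X := fun a => a n.

Lemma in_dual_proj n : in_dual (proj n).
Proof.
split=> //; first by move=> a [ca _]; exact: ca.
exists 1 => a c l2a c0 ac x; rewrite mul1r cnorm_leP// (le_trans _ (ac n.+1 x))//.
exact: (cabs2_le_psum a x n n.+1 (ltnSn n)).
Qed.

Lemma in_dualD f f' : in_dual f -> in_dual f' -> in_dual (fun a x => f a x + f' a x).
Proof.
move=> hf hf'; have [fc fD fM _] := hf; have [L L0 fL] := dual_bound f hf.
have [fc' fD' fM' _] := hf'; have [L' L0' fL'] := dual_bound f' hf'; split.
- by move=> a l2a; apply: ccontD; [exact: fc|exact: fc'].
- by move=> a b l2a l2b x; rewrite fD// fD'// addrACA.
- by move=> a b l2a cb x; rewrite fM// fM'// mulrDl.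
- exists (L + L') => a c l2a c0 ac x; rewrite mulrDl (le_trans (cnormD_le _ _))//.
  by apply: lerD; [exact: fL|exact: fL'].
Qed.

Lemma in_dual_scale f (b : X -> R[i]) : in_dual f -> ccont b ->
  in_dual (fun a x => conjc (b x) * f a x).
Proof.
move=> hf cb; have [fc fD fM _] := hf; have [L L0 fL] := dual_bound f hf; split.
- by move=> a l2a; apply: ccontM; [exact: ccontJ|exact: fc].
- by move=> a a' l2a l2a' x; rewrite fD// mulrDr.
- by move=> a b' l2a cb' x; rewrite fM// mulrA.
- have [B HB] := compact_bounded_above _ cX (continuous_cabs2 _ cb).
  exists ((`|B| + 1) * L) => a c l2a c0 ac x.
  rewrite cnorm_leP ?mulr_ge0 ?addr_ge0// cabs2M cabs2J -mulrA exprMn.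
  apply: ler_pM; rewrite ?cabs2_ge0//; last first.
    exact: cabs2_le (fL _ _ l2a c0 ac x).
  by have := HB x; have := ler_norm B; have := normr_ge0 B; nra.
Qed.

Lemma in_dual_tail f n : in_dual f -> in_dual (fun a => f (tail n a)).
Proof.
move=> hf; have [fc fD fM _] := hf; have [L L0 fL] := dual_bound f hf; split.
- by move=> a l2a; apply: fc; exact: is_l2_tail.
- move=> a b l2a l2b x; rewrite -fD; [|exact: is_l2_tail|exact: is_l2_tail].
  congr (f _ x); apply/funext => i; apply/funext => y; rewrite /tail.
  by case: ifP; rewrite ?addr0.
- move=> a b l2a cb x; rewrite -fM//; last exact: is_l2_tail.
  congr (f _ x); apply/funext => i; apply/funext => y; rewrite /tail.
  by case: ifP; rewrite ?mul0r.
- exists L => a c l2a c0 ac x; apply: fL => //; first exact: is_l2_tail.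
  move=> m y; rewrite psum_tail; case: ifP => _; first exact: sqr_ge0.
  by rewrite (le_trans _ (ac m y))// lerBlDr lerDl psum_ge0.
Qed.

Lemma coord_tail f n : in_dual f -> coord (fun a => f (tail n a)) = tail n (coord f).
Proof.
move=> hf; apply/funext => i; apply/funext => x; rewrite /coord /tail /=.
case: ifP => iN; last first.
  congr (f _ x); apply/funext => j; apply/funext => y; rewrite /unit_seq /cst.
  by case: ifP => // jn; case: (j =P i) => // ji; by rewrite ji iN in jn.
rewrite -[RHS](dual_zero f x hf); congr (f _ x); apply/funext => j; apply/funext => y.
rewrite /unit_seq /cst; case: ifPn => // jn; case: (j =P i) => // ji.
by rewrite ji iN in jn.
Qed.

(** In Paschke's module structure multiplying a functional by [c] is the action of [conjc c], whence
    the conjugate on the right. *)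
Lemma bidual_fin_functional F c n x : in_bidual F -> (forall i, ccont (c i)) ->
  F (fin_functional c n) x = \sum_(i < n) conjc (c i x) * F (proj i) x.
Proof.
move=> [_ _ FD FM _] cc; elim: n => [|n IH].
  (* The empty functional is the zero multiple of [proj 0], so homogeneity of [F] gives 0. *)
  rewrite big_ord0 -[RHS](mulr0 (F (proj 0) x)) -(FM _ (fun=> 0) (in_dual_proj 0) ccont0).
  congr (F _ x); apply/funext => a; apply/funext => y.
  by rewrite /fin_functional big_ord0 conjc0 mul0r.
have -> : fin_functional c n.+1 =
    fun a y => fin_functional c n a y + conjc (conjc (c n y)) * proj n a y.
  apply/funext => a; apply/funext => y.
  by rewrite /fin_functional big_ord_recr /= conjcK.
have cJ : ccont (fun y => conjc (c n y)) by exact: ccontJ.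
rewrite FD ?IH; [|exact: in_dual_fin_functional|exact: (in_dual_scale _ _ (in_dual_proj n) cJ)].
rewrite (FM _ _ (in_dual_proj n) cJ).
by rewrite big_ord_recr /= [F _ _ * _]mulrC.
Qed.

(** The dual of the bound on coordinates of functionals: apply [F] to the finite functional, of norm
    at most 1, whose coefficients are the normalized coordinates of [F]. The module structure
    supplies the conjugates. *)
Lemma psum_bidual_le F : in_bidual F ->
  exists B, forall n x, psum (fun i => F (proj i)) n x <= B.
Proof.
move=> hF; have [Fc _ _ _ [K FK]] := hF; exists (K ^+ 2 + 1) => n x.
set c := fun i => F (proj i).
have cc i : ccont (c i) by apply: Fc; exact: in_dual_proj.
have cn i : ccont (normalize c n i) by exact: ccont_normalize.
have n1 y : psum (normalize c n) n y <= 1 ^+ 2 by rewrite expr1n psum_normalize.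
have := FK _ _ (in_dual_fin_functional _ n cX cn) ler01
  (fbound_fin_functional _ n 1 ler01 n1) x.
rewrite mulr1 bidual_fin_functional//.
have -> : \sum_(i < n) conjc (normalize c n i x) * F (proj i) x =
    ((psum c n x / Num.sqrt (1 + psum c n x))%:C)%C.
  rewrite {2}/psum mulr_suml rmorph_sum; apply: eq_bigr => i _.
  by rewrite /normalize conjcM conjc_real mulrAC mulJc -rmorphM.
move=> h; apply: le_of_normalized; first exact: psum_ge0.
apply: le_trans h; apply: ler_of_sqr; first exact: cnorm_ge0.
by rewrite cnorm_sqr cabs2_real.
Qed.

Lemma bidual_eq0 F (hX : hausdorff_space X) : in_bidual F ->
  (forall n x, F (proj n) x = 0) -> forall f x, in_dual f -> F f x = 0.
Proof.
move=> hF F0 f x hf; have [Fc Fext FD FM [K FK]] := hF.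
(* On square summable sequences [f] is the sum of its first [n] coordinates and its tail, and [F]
   kills the former. *)
have Ftail n y : F f y = F (fun a => f (tail n a)) y.
  have cf i : ccont (coord f i) by exact: ccont_coord.
  rewrite (Fext f (fun a y => fin_functional (coord f) n a y + f (tail n a) y)) //.
  - rewrite FD; [|exact: in_dual_fin_functional|exact: in_dual_tail].
    rewrite bidual_fin_functional// big1 ?add0r// => i _.
    by rewrite F0 mulr0.
  - by apply: in_dualD; [exact: in_dual_fin_functional|exact: in_dual_tail].
  - by move=> a l2a z; exact: dual_split.
apply: cabs2_eq0; apply/eqP; apply: contrapT => /negP Ffx.
pose d := cabs2 (F f x); have d0 : 0 < d by rewrite lt_neqAle eq_sym Ffx cabs2_ge0.
have [L L0 fL] := dual_bound f hf.
(* Chosen so that [K ^+ 2 * e] stays below [d / 2], the value that [cabs2 (F f y)] exceeds on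
   [V]. *)
pose e := d / (2 * (K ^+ 2 + 1)).
have K1 : 0 < 2 * (K ^+ 2 + 1) by rewrite mulr_gt0// ltr_wpDl ?sqr_ge0.
have e0 : 0 < e by rewrite divr_gt0.
have cF : continuous (fun y => cabs2 (F f y)) by apply: continuous_cabs2; exact: Fc.
pose V := [set y | d / 2 < cabs2 (F f y)].
have oV : open V by exact: open_superlevel.
have Vx : V x by rewrite /V /= ltr_pdivrMr// mulr_natr mulr2n ltrDl.
(* One partial sum at one point of [V] comes within [e] of the supremum of all of them over [V]. By
   continuity this persists on the open set [W], so there the coordinates from [n] on have square
   sum at most [e]. *)
pose E := [set t : R | exists2 y, V y & exists n, t = psum (coord f) n y].
have supE : has_sup E.
  split; first by exists (psum (coord f) 0 x), x => //; exists 0%N.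
  by exists (L ^+ 2 + 1) => _ [y _ [n ->]]; exact: psum_coord_le.
have [_ [y Vy [n ->]] sup_lt] := sup_adherent e0 supE.
pose W := V `&` [set z | sup E - e < psum (coord f) n z].
have cf i : ccont (coord f i) by exact: ccont_coord.
have oW : open W.
  by apply: openI => //; exact: (open_superlevel _ _ (continuous_psum _ n cf)).
have [h [ch h01 hy h0]] := @urysohn_bump R X cX hX W y oW (conj Vy sup_lt).
have hT := in_dual_tail f n hf.
have chC := ccont_real _ ch.
have hS := in_dual_scale _ _ hT chC.
(* The bump confines the tail of [f] to [W], making it small in norm over all of [X], without
   changing the value of [F] at [y], where [h] is 1. *)
pose g : functional R X := fun a z => conjc ((h z)%:C)%C * f (tail n a) z.
have bS : fbound g (Num.sqrt e).
  move=> a c l2a c0 ac z; apply: (dual_cauchy_schwarz g a) => // [|m]; first exact: sqrtr_ge0.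
  rewrite sqr_sqrtr ?(ltW e0)//.
  have -> : psum (coord g) m z =
      h z ^+ 2 * psum (tail n (coord f)) m z.
    rewrite /psum mulr_sumr; apply: eq_bigr => i _.
    by rewrite -(coord_tail f n hf) /coord /g cabs2M cabs2J cabs2_real.
  have [[Vz nz]|nWz] := pselect (W z); last by rewrite h0// expr0n mul0r ltW.
  rewrite psum_tail; case: ifP => _; first by rewrite mulr0 ltW.
  have : psum (coord f) m z <= sup E.
    by apply: ub_le_sup; [case: supE|exists z => //; exists m].
  have /andP[hz0 hz1] := h01 z; move: nz; rewrite /= => nz sz.
  have hz2 : h z ^+ 2 <= 1 by rewrite expr_le1.
  by have := sqr_ge0 (h z); nra.
have := FK _ _ hS (sqrtr_ge0 e) bS y.
rewrite (FM _ _ hT chC) -Ftail hy mulr1 => /cabs2_le.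
rewrite exprMn sqr_sqrtr ?(ltW e0)// leNgt => /negP; apply.
apply: le_lt_trans Vy.
have ed : e * (2 * (K ^+ 2 + 1)) = d by rewrite divfK// gt_eqF.
by rewrite -/d -ed; nra.
Qed.
End Bidual.

(** * Disjoint open sets from families of bounded multiplicity *)

Section DisjointRefinement.

Lemma homo_ltn_step (s : nat -> nat) : (forall n, (s n < s n.+1)%N) ->
  {homo s : m n / (m < n)%N}.
Proof. by move=> sS; apply: homo_ltn => //; exact: ltn_trans. Qed.

Lemma leq_homo_ltn (s : nat -> nat) n : {homo s : m n / (m < n)%N} -> (n <= s n)%N.
Proof. by move=> hs; elim: n => // n IH; apply: leq_ltn_trans IH _; exact: hs. Qed.

(* If some W_k meets infinitely many W_j, pass to the sets W_k `&` W_j, whose multiplicity is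
   smaller; otherwise a sparse subsequence is pairwise disjoint. *)
Lemma disjoint_refinement {X : topologicalType} (m : nat) (W : nat -> set X) :
  (forall k, open (W k)) -> (forall k, W k !=set0) ->
  (forall x (s : seq nat), uniq s -> (forall k, k \in s -> W k x) -> (size s <= m)%N) ->
  exists (U : nat -> set X) (s : nat -> nat),
    [/\ forall k, open (U k), forall k, U k !=set0,
        forall k l, k <> l -> U k `&` U l = set0,
        forall k, U k `<=` W (s k) & forall k, (k <= s k)%N].
Proof.
elim: m W => [|m IH] W oW W0 Wm.
  have [x Wx] := W0 0%N.
  suff : (size [:: 0%N] <= 0)%N by [].
  by apply: (Wm x) => // k; rewrite inE => /eqP ->.
have [[k Hk]|nH] :=
  pselect (exists k, forall N, exists j, (N <= j)%N /\ W k `&` W j !=set0).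
  have [g Hg] := choice Hk.
  (* Each index is sought beyond the previous one, and the first beyond [k], so [t] is strictly
     increasing and avoids [k]. *)
  pose t := fix t n := if n is n'.+1 then g (t n').+1 else g k.+1.
  have tS n : (t n < t n.+1)%N by have [] := Hg (t n).+1.
  have ht := homo_ltn_step _ tS.
  have kt n : (k < t n)%N.
    by elim: n => [|n IHn]; [have [] := Hg k.+1|exact: ltn_trans (tS n)].
  have Wt n : W k `&` W (t n) !=set0.
    by case: n => [|n] /=; [have [] := Hg k.+1|have [] := Hg (t n).+1].
  have tinj : injective t.
    by move=> i j tij; case: (ltngtP i j) => // /ht; rewrite tij ltnn.
  have [|//||U [s [oU U0 Ud UW ks]]] := IH (fun n => W k `&` W (t n)).
  - by move=> n; exact: openI.
  - move=> x s us sx; case: s us sx => // j s us sx.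
    (* A point of some [W k] [&] [W (t j)] also lies in [W k], so [k] can be added to the list; this
       lowers the multiplicity by one. *)
    suff: (size (k :: map t (j :: s)) <= m.+1)%N by rewrite /= size_map.
    apply: (Wm x) => [|i].
      rewrite cons_uniq map_inj_uniq// us andbT; apply/negP => /mapP[i _ ki].
      by have := kt i; rewrite -ki ltnn.
    rewrite inE => /orP[/eqP ->|/mapP[i' i's ->]].
      by have [] := sx j (mem_head _ _).
    by have [] := sx _ i's.
  exists U, (t \o s); split => //.
  - by move=> n x /UW[].
  - by move=> n; exact: leq_trans (ks n) (leq_homo_ltn t _ ht).
have Hd k : exists N, forall j, (N <= j)%N -> W k `&` W j = set0.
  apply: contrapT => Hk; apply: nH; exists k => N; apply: contrapT => HN.
  apply: Hk; exists N => j Nj; apply: contrapT => /eqP/set0P WW; apply: HN.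
  by exists j.
have [g Hg] := choice Hd.
(* Otherwise [W k] would be disjoint from itself, although it is nonempty. *)
have kg k : (k < g k)%N.
  rewrite ltnNge; apply/negP => /Hg; rewrite setIid.
  by apply/eqP/set0P; exact: W0.
pose s := fix s n := if n is n'.+1 then g (s n') else 0%N.
have hs : {homo s : m n / (m < n)%N} by apply: homo_ltn_step => n; exact: kg.
have Wd k l : (k < l)%N -> W (s k) `&` W (s l) = set0.
  rewrite leq_eqVlt => /orP[/eqP <-|/hs]; first by rewrite (Hg (s k)).
  by move=> /ltnW; exact: (Hg (s k)).
exists (W \o s), s; split => //=.
- by move=> k l /eqP; rewrite neq_ltn => /orP[/Wd//|/Wd]; rewrite setIC.
- by move=> k x.
- by move=> k; exact: (leq_homo_ltn s k hs).
Qed.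

End DisjointRefinement.

(** * Disjoint open sets on which blocks of squares stay large *)

Section Blocks.
Context {R : realType} {X : topologicalType}.

Lemma sum_uniq_le (D : nat -> R) (s : seq nat) n : (forall k, 0 <= D k) -> uniq s ->
  (forall k, k \in s -> (k < n)%N) -> \sum_(k <- s) D k <= \sum_(k < n) D k.
Proof.
move=> D0 us sn; rewrite -(big_mkord xpredT D).
have ps : perm_eq s [seq k <- index_iota 0 n | k \in s].
  apply: uniq_perm => //; first exact/filter_uniq/iota_uniq.
  move=> k; rewrite mem_filter mem_index_iota /=.
  by case: (boolP (k \in s)) => // /sn ->.
rewrite (perm_big _ ps) big_filter big_mkcond; apply: ler_sum => k _.
by case: ifP.
Qed.

(** A point where [j] consecutive-index blocks each exceed [e] satisfies [j * e <= B], so the sets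
    where the blocks are large have bounded multiplicity and admit a disjoint refinement. *)
Lemma disjoint_blocks (a : seqX R X) (B : R) : (forall i, ccont (a i)) ->
  (forall n x, psum a n x <= B) -> ~ uniformly_cauchy a ->
  exists (e : R) (U : nat -> set X) (l r : nat -> nat), 0 < e /\
    [/\ forall k, open (U k), forall k, U k !=set0,
        forall k l, k <> l -> U k `&` U l = set0,
        forall k x, U k x -> e < psum a (r k) x - psum a (l k) x
      & forall k, (k <= l k)%N /\ (l k <= r k)%N].
Proof.
move=> ca aB nC.
have [e [e0 He]] : exists e : R, 0 < e /\ forall N, exists n, (N <= n)%N /\
    exists x, e < psum a n x - psum a N x.
  apply: contrapT => H; apply: nC => e e0; apply: contrapT => He; apply: H.
  exists e; split => // N; apply: contrapT => HN; apply: He; exists N => n Nn x.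
  by rewrite leNgt; apply/negP => xe; apply: HN; exists n; split => //; exists x.
have [g Hg] := choice He.
pose N := fix N n := if n is n'.+1 then g (N n') else 0%N.
have NS n : (N n <= N n.+1)%N by have [] := Hg (N n).
(* Strict because the block between the two indices exceeds [e > 0] at some point, so it is not
   empty. *)
have NSlt n : (N n < N n.+1)%N.
  rewrite ltn_neqAle NS andbT; apply/negP => /eqP NN.
  by have [_ [x]] := Hg (N n); rewrite -[g _]/(N n.+1) -NN subrr ltNge ltW.
have hN := homo_ltn_step _ NSlt.
pose D k x := psum a (N k.+1) x - psum a (N k) x.
have D0 k x : 0 <= D k x by rewrite subr_ge0; exact: psum_nondecreasing.
have sumD n x : \sum_(k < n) D k x = psum a (N n) x.
  elim: n => [|n IH]; first by rewrite big_ord0 /psum big_ord0.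
  by rewrite big_ord_recr /= IH /D addrC subrK.
have cD k : continuous (D k).
  by move=> x; apply: cvgB; exact: continuous_psum.
have [m Hm] : exists m : nat, B / e < m%:R.
  exists (Num.bound `|B / e|).
  exact: le_lt_trans (ler_norm _) (archi_boundP (normr_ge0 _)).
have [||x s us sx|U [s [oU U0 Ud UW ks]]] :=
  disjoint_refinement m (fun k => [set x | e < D k x]).
- by move=> k; exact: (open_superlevel _ _ (cD k)).
- by move=> k; have [_ [x]] := Hg (N k); exists x.
- have sB : \sum_(k <- s) D k x <= B.
    apply: le_trans (sum_uniq_le (D^~ x) s (\max_(k <- s) k).+1 _ us _) _ => //.
      by move=> k ks; rewrite ltnS; exact: leq_bigmax_seq.
    by rewrite sumD.
  have : (size s)%:R * e <= B.
    apply: le_trans sB; rewrite mulr_natl -iter_addr_0 -count_predT -big_const_seq.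
    by rewrite big_seq [leRHS]big_seq; apply: ler_sum => k /sx /ltW.
  rewrite -ler_pdivlMr// => /le_lt_trans/(_ Hm); rewrite ltr_nat; exact: ltnW.
exists e, U, (N \o s), (N \o S \o s); split => //; split => //.
move=> k; split; last exact: NS.
exact: leq_trans (ks k) (leq_homo_ltn N _ hN).
Qed.

End Blocks.

(** * Functionals glued over disjoint open sets, and the canonical inclusion they give *)

Section Gluing.
Context {R : realType} {X : topologicalType}.
Hypothesis cX : compact [set: X].
Hypothesis hX : hausdorff_space X.

Section GluedFunctional.
Variables (U : nat -> set X) (l r : nat -> nat) (c : nat -> seqX R X) (C : R).
Hypothesis Udisj : forall k k', k <> k' -> U k `&` U k' = set0.
Hypothesis kl : forall k, (k <= l k)%N.
Hypothesis cc : forall k i, ccont (c k i).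
Hypothesis c_low : forall k i x, (i < l k)%N -> c k i x = 0.
Hypothesis c_off : forall k i x, ~ U k x -> c k i x = 0.
Hypothesis C0 : 0 <= C.
Hypothesis cC : forall k x, psum (c k) (r k) x <= C ^+ 2.

Let p k : functional R X := fin_functional (c k) (r k).
(** Off the union of the [U k] the default index 0 is harmless, since the coefficients of [p 0]
    vanish off [U 0]. *)
Let index x := xget 0%N [set k | U k x].

Definition glued : functional R X := fun a x => p (index x) a x.

Lemma index_eq k x : U k x -> index x = k.
Proof.
move=> Ux; apply: contrapT => jk; have := Udisj _ _ jk.
move/seteqP => [/(_ x) + _]; apply; split => //.
exact: (@xgetPex _ 0%N [set k | U k x] (ex_intro _ k Ux)).
Qed.

Lemma glued_on k a x : U k x -> glued a x = p k a x.
Proof. by move=> /index_eq; rewrite /glued => ->. Qed.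

Lemma fin_functional_off k a x : ~ U k x -> p k a x = 0.
Proof. by move=> nU; rewrite /p /fin_functional big1// => i _; rewrite c_off// mul0r. Qed.

Lemma glued_off a x : (forall k, ~ U k x) -> glued a x = 0.
Proof. by move=> nU; exact: fin_functional_off. Qed.

Lemma sum_fin_functional n a x :
  \sum_(k < n) p k a x = if (index x < n)%N then glued a x else 0.
Proof.
have off k : k != index x -> p k a x = 0.
  by move=> kx; apply: fin_functional_off => /index_eq Ek; rewrite Ek eqxx in kx.
case: ifP => xn; last first.
  rewrite big1// => k _; apply: off; apply/eqP => kx.
  by rewrite -kx ltn_ord in xn.
by rewrite (bigD1 (Ordinal xn))//= big1 ?addr0// => k kx; exact: off.
Qed.

Lemma fin_functional_tail k n a x : (n <= k)%N -> p k (tail n a) x = p k a x.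
Proof.
move=> nk; apply: eq_bigr => i _; rewrite /tail; case: ltnP => // iN.
by rewrite c_low ?mul0r// (leq_trans iN)// (leq_trans nk).
Qed.

(** Linearity and the bound [C] hold pointwise, from a single [p k]. Continuity is the issue: the
    pieces with [k >= n] have no coefficients below [n], hence see only the tail of [a], so finite
    sums of the [p k] converge uniformly. *)
Lemma in_dual_glued : in_dual glued.
Proof.
have hp k : in_dual (p k) by exact: in_dual_fin_functional.
have bp k : fbound (p k) C by exact: fbound_fin_functional.
split.
- move=> a l2a; apply: ccont_uniform_limit => e e0.
  have C1 : 0 < C + 1 by rewrite ltr_wpDl.
  have [n an] := l2le_tail a _ l2a (divr_gt0 e0 C1).
  exists (fun x => \sum_(k < n) p k a x) => [|x].
    by apply: ccont_sum => k; case: (hp k) => + _ _ _; exact.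
  rewrite sum_fin_functional; case: ltnP => xn; first by rewrite subrr cabs20 sqr_ge0.
  rewrite subr0 /glued -(fin_functional_tail _ n)//.
  apply: cabs2_le; have eC := ltW (divr_gt0 e0 C1).
  apply: le_trans (bp _ _ _ (is_l2_tail n a l2a) eC an x) _.
  by rewrite mulrA ler_pdivrMr// mulrDr mulr1 mulrC lerDl ltW.
- by move=> a b l2a l2b x; case: (hp (index x)) => _ + _ _; exact.
- by move=> a b l2a cb x; case: (hp (index x)) => _ _ + _; exact.
- by exists C => a d l2a d0 ad x; exact: bp.
Qed.

End GluedFunctional.

(** [F] is local: multiplying the glued functional by a bump supported in [U k] leaves a finite
    functional, whose image is computed from the coordinates of [F]. *)
Lemma prod_canon_incl_of_blocks (F : functional R X -> X -> R[i]) (U : nat -> set X)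
    (l r : nat -> nat) (e : R) : let A i := F (proj i) in
  in_bidual F -> 0 < e -> (forall k, open (U k)) ->
  (forall k k', k <> k' -> U k `&` U k' = set0) ->
  (forall k x, U k x -> e < psum A (r k) x - psum A (l k) x) ->
  (forall k, (k <= l k)%N /\ (l k <= r k)%N) ->
  prod_canon_incl R U.
Proof.
move=> A hF e0 oU Ud Ue klr lam lamU [B0 lamB0].
pose B := `|B0|; have lamB k x : cabs2 (lam k x) <= B ^+ 2.
  exact: cabs2_le (le_trans (lamB0 k x) (ler_norm _)).
have [Fc _ _ FM _] := hF.
have cA i : ccont (A i) by apply: Fc; exact: in_dual_proj.
pose b k x := psum A (r k) x - psum A (l k) x.
have b0 k x : 0 <= b k x by rewrite subr_ge0 psum_nondecreasing//; case: (klr k).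
(* On [U k], where [b k] exceeds [e], this is the inverse of [b k]; the maximum makes it continuous
   on all of [X]. *)
pose w k x := (Num.max e (b k x))^-1.
have m0 k x : 0 < Num.max e (b k x) by rewrite lt_max e0.
have cw k : continuous (w k).
  move=> x; apply: cvgV; first by rewrite gt_eqF.
  have cb : {for x, continuous (b k : X -> R^o)}.
    by apply: cvgB; exact: continuous_psum.
  exact: (continuous_max (@cst_continuous _ _ (e : R^o) x) cb).
pose d k x := conjc (lam k x) * ((w k x)%:C)%C.
have cd k : ccont (d k).
  by apply: ccontM; [apply: ccontJ; case: (lamU k)|exact: ccont_real].
pose c k : seqX R X := fun i x => tail (l k) A i x * d k x.
have ctail k i : ccont (tail (l k) A i).
  by rewrite /tail; case: (i < l k)%N => //; exact: ccont0.
have cc k i : ccont (c k i) by exact: ccontM.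
have c_low k i x : (i < l k)%N -> c k i x = 0 by rewrite /c /tail => ->; rewrite mul0r.
have c_off k i x : ~ U k x -> c k i x = 0.
  by move=> nU; rewrite /c /d; case: (lamU k) => _ ->//; rewrite conjc0 mul0r mulr0.
(* From [e * b <= max e b ^+ 2] follows [b * w ^+ 2 <= 1 / e], which gives the coefficients square
   sum at most [B ^+ 2 / e]. *)
pose C := B / Num.sqrt e.
have C0 : 0 <= C by apply: divr_ge0; [exact: normr_ge0|exact: sqrtr_ge0].
have psum_c k x : psum (c k) (r k) x = b k x * (cabs2 (lam k x) * w k x ^+ 2).
  rewrite /b -psum_tail_ge; last by case: (klr k).
  rewrite /psum mulr_suml; apply: eq_bigr => i _.
  by rewrite cabs2M /d cabs2M cabs2J cabs2_real.
have cC k x : psum (c k) (r k) x <= C ^+ 2.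
  have -> : C ^+ 2 = B ^+ 2 / e by rewrite /C exprMn exprVn sqr_sqrtr ?(ltW e0).
  rewrite psum_c mulrCA.
  apply: ler_pM => //; [exact: cabs2_ge0|by rewrite mulr_ge0 ?sqr_ge0|].
  rewrite /w exprVn ler_pdivrMr ?exprn_gt0// ler_pdivlMl//.
  by apply: ler_pM; rewrite ?(ltW e0)// ?le_max ?lexx ?orbT.
pose f := glued U r c.
have hf : in_dual f by apply: (in_dual_glued U l r c C) => // k; case: (klr k).
exists (F f); split.
- exact: Fc.
- move=> k x Ux; have [h [ch h01 hx h0]] := @urysohn_bump R X cX hX _ x (oU k) Ux.
  have := FM f _ hf (ccont_real _ ch) x; rewrite hx mulr1 => <-.
  have -> : (fun a y => conjc ((h y)%:C)%C * f a y) =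
      fin_functional (fun i y => conjc ((h y)%:C)%C * c k i y) (r k).
    apply/funext => a; apply/funext => y; rewrite /fin_functional.
    have [Uy|nU] := pselect (U k y).
      rewrite /f (glued_on _ _ _ Ud _ _ _ Uy) /fin_functional mulr_sumr.
      by apply: eq_bigr => i _; rewrite mulrA.
    by rewrite h0// conjc0 mul0r big1// => i _; rewrite !mul0r.
  rewrite bidual_fin_functional//; last first.
    by move=> i; apply: ccontM => //; apply: ccontJ; exact: ccont_real.
  rewrite hx.
  (* At a point of [U k] the maximum in [w] is [b k x], so the inserted factor is 1; its sum of
     squares then matches the coefficients term by term. *)
  have -> : lam k x = ((b k x * w k x)%:C)%C * lam k x.
    have /ltW be := Ue _ _ Ux.
    by rewrite /w (max_idPr be) divff ?mul1r// gt_eqF// (lt_le_trans e0).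
  rewrite /b -psum_tail_ge; last by case: (klr k).
  rewrite /psum mulr_suml rmorph_sum mulr_suml; apply: eq_bigr => i _.
  rewrite conjc1 mul1r /c /d !conjcM conjcK conjc_real.
  rewrite /= real_complexM -mulJc.
  rewrite /tail; case: ifP => _; first by rewrite conjc0 !mul0r.
  by rewrite mulrAC -!mulrA; congr (_ * _); rewrite mulrCA mulrC -!mulrA.
- move=> x nx; have oV : open (~` closure (\bigcup_k U k)).
    by apply: closed_openC; exact: closed_closure.
  have [h [ch h01 hx h0]] := @urysohn_bump R X cX hX _ x oV nx.
  have := FM f _ hf (ccont_real _ ch) x; rewrite hx mulr1 => <-.
  (* A bump supported off the closure annihilates the glued functional, leaving the empty finite
     functional. *)
  have -> : (fun a y => conjc ((h y)%:C)%C * f a y) = fin_functional (c 0%N) 0.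
    apply/funext => a; apply/funext => y; rewrite /fin_functional big_ord0.
    have [Vy|nVy] := pselect ((~` closure (\bigcup_k U k)) y); last first.
      by rewrite h0// conjc0 mul0r.
    rewrite /f (glued_off U r c c_off) ?mulr0// => k Uy.
    by apply: Vy; apply: subset_closure; exists k.
  by rewrite bidual_fin_functional// big_ord0.
Qed.

End Gluing.

(** * Reflexivity in terms of bidual coordinates, and its failure under a canonical inclusion *)

Section NonReflexive.
Context {R : realType} {X : topologicalType}.

(** The glued function is unique, so each module identity for [F] need only be checked on the sets
    [U k]. *)
Lemma not_reflexive_of_incl (U : nat -> set X) :
  compact [set: X] -> hausdorff_space X ->
  (forall k, open (U k)) -> (forall k, U k !=set0) ->
  (forall k l, k <> l -> U k `&` U l = set0) ->
  prod_canon_incl R U -> ~ l2_reflexive R X.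
Proof.
move=> cX hX oU U0 Ud incl refl.
have [xi Uxi] := choice U0.
have [h Hh] := choice (fun k => @urysohn_bump R X cX hX _ _ (oU k) (Uxi k)).
pose lam (f : functional R X) k x := ((h k x)%:C)%C * conjc (coord f k x).
pose is_glue f g := [/\ ccont g, (forall k x, U k x -> g x = lam f k x)
  & (forall x, ~ closure (\bigcup_k U k) x -> g x = 0)].
(* The default zero function concerns only functionals outside the dual; on the dual a glued
   function exists. *)
pose F f : X -> R[i] := xget (fun=> 0) [set g | is_glue f g].
have lam_le f L x k : in_dual f -> 0 <= L -> fbound f L -> cabs2 (lam f k x) <= L ^+ 2.
  move=> hf L0 fL; rewrite cabs2M cabs2_real cabs2J.
  have [_ /(_ x)/andP[h0 h1] _ _] := Hh k.
  have := fL _ _ (is_l2_unit_seq k) ler01 (l2le_unit_seq k) x.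
  rewrite mulr1 => /cabs2_le; apply: le_trans.
  by rewrite ler_piMl ?cabs2_ge0// expr_le1.
have F_glue f : in_dual f -> is_glue f (F f).
  move=> hf; apply: (@xgetPex _ _ [set g | is_glue f g]); apply: incl => [k|].
    have [ch _ _ hU] := Hh k; split; last by move=> x /hU hx; rewrite /lam hx mul0r.
    by apply: ccontM; [exact: ccont_real|apply: ccontJ; exact: ccont_coord].
  have [L L0 fL] := dual_bound f hf; exists L => k x.
  by rewrite cnorm_leP//; exact: lam_le.
(* Two glued functions agree on the union of the [U k], hence by continuity on its closure, and both
   vanish elsewhere. *)
have glue_eq f g g' : is_glue f g -> is_glue f g' -> forall x, g x = g' x.
  move=> [cg gU g0] [cg' gU' g0'] x; apply/eqP; rewrite -subr_eq0; apply/eqP.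
  have [Dx|nD] := pselect (closure (\bigcup_k U k) x); last by rewrite g0// g0'// subr0.
  apply: cabs2_eq0; apply/eqP; rewrite eq_le cabs2_ge0 andbT.
  have cN : ccont (fun y => g y + (-1) * g' y).
    apply: ccontD => //; apply: ccontM => //.
    by have := ccont_real (fun=> -1 : R) (@cst_continuous X R (-1)); rewrite rmorphN1.
  rewrite -mulN1r.
  apply: (closure_le _ 0 _ (continuous_cabs2 _ cN)) Dx => y [k _ Uy].
  by rewrite (gU k)// (gU' k)// mulN1r subrr cabs20.
have hF : in_bidual F.
  split.
  - by move=> f /F_glue[].
  - move=> f g hf hg fg; apply: glue_eq (F_glue _ hf) _.
    have [cg gU g0] := F_glue _ hg; split => // k x Ux.
    by rewrite (gU k)// /lam /coord fg//; exact: is_l2_unit_seq.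
  - move=> f g hf hg; apply: glue_eq (F_glue _ (in_dualD _ _ hf hg)) _.
    have [cf fU f0] := F_glue _ hf; have [cg gU g0] := F_glue _ hg; split.
    + exact: ccontD.
    + move=> k x Ux; rewrite (fU k)// (gU k)// /lam -mulrDr; congr (_ * _).
      by rewrite /coord conjcD.
    + by move=> x nx; rewrite f0// g0// addr0.
  - move=> f b hf cb; apply: glue_eq (F_glue _ (in_dual_scale cX _ _ hf cb)) _.
    have [cf fU f0] := F_glue _ hf; split.
    + exact: ccontM.
    + move=> k x Ux; rewrite (fU k)// /lam /coord conjcM conjcK.
      by rewrite -!mulrA; congr (_ * _); rewrite mulrC.
    + by move=> x nx; rewrite f0// mul0r.
  - exists 1 => f L hf L0 fL x; rewrite mul1r cnorm_leP//.
    have [cf fU f0] := F_glue _ hf.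
    have [Dx|nD] := pselect (closure (\bigcup_k U k) x); last first.
      by rewrite f0// cabs20 sqr_ge0.
    apply: (closure_le _ (L ^+ 2) _ (continuous_cabs2 _ cf)) Dx => y [k _ Uy].
    by rewrite (fU k)//; exact: lam_le.
have [a [l2a Fa]] := refl F hF.
(* A representing sequence would have its [N]-th term of squared modulus at most 1/2 everywhere, yet
   at [xi N] it equals the conjugate of [h N (xi N) = 1]. *)
have [N HN] := is_l2_cauchy _ l2a 2^-1 ltac:(by rewrite invr_gt0).
have := HN _ (leqnSn N) (xi N); rewrite psumS addrAC subrr add0r.
have := Fa _ (in_dual_proj N) (xi N).
have [_ FU _] := F_glue _ (in_dual_proj N); rewrite (FU N _ (Uxi N)).
have [_ _ hN _] := Hh N.
rewrite /lam hN /coord /proj /unit_seq /cst eqxx conjc1 mulr1.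
move=> /(congr1 cabs2); rewrite cabs2J cabs2_real expr1n => <-; lra.
Qed.

(** The conjugate coordinates form an element [a] of $l_2(C(X))$. Subtracting evaluation at [a] from
    [F] leaves a bidual element that kills every [proj n], hence vanishes. *)
Lemma reflexive_of_cauchy (F : functional R X -> X -> R[i]) :
  compact [set: X] -> hausdorff_space X -> in_bidual F ->
  uniformly_cauchy (fun i => F (proj i)) ->
  exists a : seqX R X, is_l2 a /\ forall f, in_dual f -> forall x, F f x = conjc (f a x).
Proof.
move=> cX hX hF CF; have [Fc Fext FD FM [K FK]] := hF.
pose a : seqX R X := fun i x => conjc (F (proj i) x).
have ca i : ccont (a i) by apply: ccontJ; apply: Fc; exact: in_dual_proj.
have l2a : is_l2 a.
  apply: cauchy_is_l2 => // e /CF[N HN]; exists N => n Nn x.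
  have := HN n Nn x; rewrite /psum.
  by under eq_bigr do rewrite -cabs2J; under [X in _ - X]eq_bigr do rewrite -cabs2J.
have [c c0 ac] := l2le_exists a cX l2a.
exists a; split => // f hf x.
pose G (g : functional R X) y := F g y + conjc (- g a y).
suff : G f x = 0.
  by move/eqP; rewrite /G conjcN subr_eq0 => /eqP.
have G0 n y : G (proj n) y = 0 by rewrite /G /proj /a conjcN conjcK subrr.
apply: (bidual_eq0 cX _ hX _ G0 f x hf); split.
- move=> g hg; apply: ccontD; first exact: Fc.
  have [gc _ _ _] := hg.
  have := ccontM _ _ (gc _ l2a) (ccont_real (fun=> -1 : R) (@cst_continuous X R (-1))).
  by move=> /ccontJ; under eq_fun do rewrite rmorphN1 mulrN1.
- by move=> g g' hg hg' gg' y; rewrite /G (Fext g g')// gg'.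
- move=> g g' hg hg' y; rewrite /G FD// opprD conjcD.
  by rewrite addrACA.
- move=> g b hg cb y; rewrite /G FM// mulrDl; congr (_ + _).
  by rewrite -mulrN conjcM conjcK mulrC.
(* [K] bounds [F], and evaluation at [a] is bounded by the norm bound [c] of [a]. *)
- exists (K + c) => g L hg L0 gL y; rewrite /G mulrDl (le_trans (cnormD_le _ _))//.
  apply: lerD; first exact: FK.
  rewrite mulrC cnorm_leP ?mulr_ge0// cabs2J -mulN1r cabs2M.
  have -> : cabs2 (-1 : R[i]) = 1 by rewrite /cabs2 /= oppr0 sqrrN expr1n expr0n addr0.
  by rewrite mul1r -cnorm_leP ?mulr_ge0//; exact: gL.
Qed.

End NonReflexive.

Theorem theorem5p5 (R : realType) (X : topologicalType)
    (hcomp : compact [set: X]) (hhaus : hausdorff_space X) :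
  ~ l2_reflexive R X <->
  exists U : nat -> set X,
    [/\ forall k, open (U k),
        forall k, U k !=set0,
        forall k l, k <> l -> U k `&` U l = set0
      & prod_canon_incl R U].
Proof.
split=> [nrefl|[U [oU U0 Ud incl]]]; last exact: (not_reflexive_of_incl U).
(* If all bidual elements had uniformly Cauchy coordinates, each would be an evaluation and the
   module would be reflexive. *)
have [F [hF nF]] : exists F : functional R X -> X -> R[i], in_bidual F /\
    ~ uniformly_cauchy (fun i => F (proj i)).
  apply: contrapT => H; apply: nrefl => F hF; apply: reflexive_of_cauchy => //.
  by apply: contrapT => nC; apply: H; exists F.
have cA i : ccont (F (proj i)) by have [Fc _ _ _ _] := hF; apply: Fc; exact: in_dual_proj.
have [B HB] := psum_bidual_le hcomp F hF.
have [e [U [l [r [e0 [oU U0 Ud Ue klr]]]]]] := disjoint_blocks _ B cA HB nF.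
exists U; split => //.
exact: (prod_canon_incl_of_blocks hcomp hhaus F U l r e).
Qed.
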